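(* Let $\alpha: G_0\curvearrowright X$ be a distal action on the Cantor set $X$ of a countable discrete group $G_0$ of local sub-exponential growth, and suppose the free points of $\alpha$ are dense. Let $T$ be a finite symmetric subset of $[[\alpha]]$ containing $\mathrm{id}_X$. For each $\varphi\in T$, choose a continuous orbit cocycle $c(\varphi):X \to G_0$, write $S=\bigcup_{\varphi\in T}\operatorname{ran}(c(\varphi))\subset G_0$, where $\operatorname{ran}(c(\varphi))$ is the range of $c(\varphi)$, and suppose $S$ is symmetric and contains $e_{G_0}$. Let $G=\langle S\rangle\le G_0$ and $\Gamma=\langle T\rangle\leq [[\alpha]]$. Then there is an $l\in \mathbb{N}$ depending only on $T$ such that for any $\epsilon>0$ (for which $\delta(\epsilon)$ below is defined) one has $$\operatorname{F{\o}l}_{\Gamma, T}(\epsilon)\leq \Big(\Psi_{S, \delta(\epsilon)}\big(\lceil\log(\delta(\epsilon))/\log(1-\delta(\epsilon))\rceil\big)\Big)^{l},$$ where $$\delta(\epsilon)= \min\left\{\frac{\epsilon}{(1+2|T|)\cdot 2^l|T|^2\cdot 2|S|(|S|+2)},\ 1-\sqrt{1-\frac{\epsilon}{(1+2|T|)\cdot 2^l|T|^2\cdot 2|S|}}\right\}.$$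
   Context: A group has local sub-exponential growth if every finitely generated subgroup has sub-exponential growth. An action $\alpha:G_0\curvearrowright X$ is distal if $\inf_{g}d(gx,gy)>0$ whenever $x\neq y$ ($d$ a compatible metric on $X$). A point is free if its stabilizer is trivial. $[[\alpha]]$ is the group of all homeomorphisms $\varphi$ of $X$ for which there is a continuous map $c(\varphi):X\to G_0$ ($G_0$ discrete), called a continuous orbit cocycle, with $\varphi(x)=\alpha_{c(\varphi)(x)}(x)$ for all $x\in X$. For a group $\Lambda$ generated by a finite set $Q$: $\partial_Q^-F=\{g\in F: Qg\not\subset F\}$ for finite $F\subset\Lambda$, and $\operatorname{F{\o}l}_{\Lambda,Q}(\epsilon)=\min\{|F|: F\subset\Lambda\text{ finite nonempty}, |\partial_Q^-F|\leq\epsilon|F|\}$. For $G$ generated by the finite symmetric set $S\ni e$: $B(G,r)$ is the closed ball of radius $r$ around $e$ in the Cayley graph of $(G,S)$, $\operatorname{Vol}(r)=|B(G,r)|$, and $\widetilde{\operatorname{F{\o}l}}_{G,S}(\epsilon)=\min\{r\in\mathbb{N}_+: |\partial_S^-B(G,r)|\leq\epsilon|B(G,r)|\}$. For $\epsilon>0$ the function $\Psi_{S,\epsilon}:\mathbb{N}_+\to\mathbb{N}_+$ is defined recursively by $\Psi_{S,\epsilon}(1)=\operatorname{Vol}(1)$ and $$\Psi_{S,\epsilon}(m+1)=\operatorname{Vol}\left(\widetilde{\operatorname{F{\o}l}}_{G,S}\left(\frac{\epsilon}{16\cdot(\Psi_{S,\epsilon}(m))^3\cdot(|S|+1)}\right)\right).$$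 *)

(* Defs.v *)
From HB Require Import structures.
From mathcomp Require Import all_boot all_order all_algebra finmap.
From mathcomp Require Import all_classical all_reals all_analysis.

Set Implicit Arguments.
Unset Strict Implicit.
Unset Printing Implicit Defensive.

Import Order.TTheory GRing.Theory Num.Theory.
Import numFieldNormedType.Exports.

Local Open Scope fset_scope.
Local Open Scope classical_set_scope.
Local Open Scope ring_scope.

Definition homeomorphic (X Y : topologicalType) : Prop :=
  exists (f : X -> Y) (g : Y -> X),
    [/\ cancel f g, cancel g f, continuous f & continuous g].

Record homeo (X : topologicalType) : Type := Homeo {
  homeo_fun :> X -> X;
  homeo_inv : X -> X;
  homeoK : cancel homeo_fun homeo_inv;
  homeoVK : cancel homeo_inv homeo_fun;
  homeo_continuous : continuous homeo_fun;
  homeo_inv_continuous : continuous homeo_inv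
}.

(* Equality of homeomorphisms is equality of the underlying maps. *)
Lemma homeoP (X : topologicalType) (f g : homeo X) : f =1 g -> f = g.
Proof.
case: f g => [f f' fK f'K fc f'c] [g g' gK g'K gc g'c] /= efg.
have {}efg : f = g by exact: funext.
subst g.
have efg' : f' = g' by apply: funext => x; apply: (can_inj gK); rewrite f'K g'K.
by subst g'; congr Homeo; exact: Prop_irrelevance.
Qed.

Section HomeoGroup.
Variable X : topologicalType.

HB.instance Definition _ := gen_eqMixin (homeo X).
HB.instance Definition _ := gen_choiceMixin (homeo X).

Fact homeo_id_continuous : continuous (@id X).
Proof. by move=> x; exact: cvg_id. Qed.

Definition homeo_one : homeo X :=
  @Homeo X id id (fun=> erefl) (fun=> erefl)
    homeo_id_continuous homeo_id_continuous.

Definition homeo_opp (f : homeo X) : homeo X :=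
  Homeo (@homeoVK X f) (@homeoK X f)
    (@homeo_inv_continuous X f) (@homeo_continuous X f).

Fact homeo_comp_continuous (f g : X -> X) :
  continuous f -> continuous g -> continuous (f \o g).
Proof. by move=> fc gc x; apply: continuous_comp; [exact: gc|exact: fc]. Qed.

Definition homeo_comp (f g : homeo X) : homeo X :=
  @Homeo X (homeo_fun f \o homeo_fun g) (homeo_inv g \o homeo_inv f)
    (can_comp (@homeoK X f) (@homeoK X g))
    (can_comp (@homeoVK X g) (@homeoVK X f))
    (homeo_comp_continuous (@homeo_continuous X f) (@homeo_continuous X g))
    (homeo_comp_continuous (@homeo_inv_continuous X g)
                           (@homeo_inv_continuous X f)).

Fact homeo_compA : associative homeo_comp.
Proof. by move=> f g h; exact: homeoP. Qed.
Fact homeo_comp1f : left_id homeo_one homeo_comp.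
Proof. by move=> f; exact: homeoP. Qed.
Fact homeo_compf1 : right_id homeo_one homeo_comp.
Proof. by move=> f; exact: homeoP. Qed.
Fact homeo_compVf : left_inverse homeo_one homeo_opp homeo_comp.
Proof. by move=> f; apply: homeoP => x; exact: homeoK. Qed.
Fact homeo_compfV : right_inverse homeo_one homeo_opp homeo_comp.
Proof. by move=> f; apply: homeoP => x; exact: homeoVK. Qed.

HB.instance Definition _ := isGroup.Build (homeo X)
  homeo_compA homeo_comp1f homeo_compf1 homeo_compVf homeo_compfV.

End HomeoGroup.

Section Groups.
Variables (R : realType) (G : groupType).
Implicit Types (Q S F : {fset G}) (H : set G) (eps : R).

Definition subgroup H : Prop :=
  H 1%g /\ forall x y, H x -> H y -> H (x / y)%g.

Definition generated Q : set G := smallest subgroup [set` Q].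

Definition symmetric_fset S : Prop := forall s, s \in S -> (s^-1)%g \in S.

(* The closed ball of radius r around 1 in the Cayley graph with edges
   g -- s * g (s in S); used for symmetric S only, where the convention
   g -- g * s gives the same balls around 1. *)
Fixpoint ball_cayley S (r : nat) : {fset G} :=
  if r is r'.+1
  then (ball_cayley S r' `|`
          [fset (s * g)%g | s in S, g in ball_cayley S r'])%fset
  else [fset 1%g].

Definition Vol S (r : nat) : nat := #|` ball_cayley S r|.

(* Vol(n)^(1/n) --> 1, with respect to any finite symmetric generating set. *)
Definition subexponential_growth H : Prop :=
  forall S, symmetric_fset S -> generated S = H ->
    (Vol S n)%:R `^ (n%:R^-1) @[n --> \oo] --> (1 : R).

Definition local_subexponential_growth : Prop :=
  forall H, subgroup H -> (exists Q, H = generated Q) ->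
    subexponential_growth H.

Definition inner_boundary Q F : {fset G} :=
  [fset g in F | ~~ ([fset (q * g)%g | q in Q] `<=` F)%fset].

(* The Folner function of the group generated by Q. Its value is +oo when no
   set F is admissible, as the infimum of the empty set; otherwise the infimum
   is a minimum, the cardinals being natural numbers. *)
Definition folner Q eps : \bar R :=
  ereal_inf [set (#|` F|%:R : R)%:E | F in
    [set F | [/\ F != fset0, [set` F] `<=` generated Q &
                 #|` inner_boundary Q F|%:R <= eps * #|` F|%:R]]].

(* The least element of P, and 0 if P is empty. *)
Definition least (P : set nat) : nat :=
  xget 0%N [set n | P n /\ forall m, P m -> (n <= m)%N].

(* The default value 0 does not occur for eps > 0 when the group generated by S
   has subexponential growth. *)
Definition folner_radius S eps : nat :=
  least [set r | (0 < r)%N /\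
    #|` inner_boundary S (ball_cayley S r)|%:R <= eps * (Vol S r)%:R].

(* Psi_rec S eps n is Psi(n + 1). *)
Fixpoint Psi_rec S eps (n : nat) : nat :=
  if n is n'.+1
  then Vol S (folner_radius S
         (eps / (16 * (Psi_rec S eps n')%:R ^+ 3 * (#|` S|%:R + 1))))
  else Vol S 1.

(* Meaningful for m > 0 only. *)
Definition Psi S eps (m : nat) : nat := Psi_rec S eps m.-1.

End Groups.

Section Actions.
Variables (R : realType) (X : metricType R) (G0 : groupType).
Variable alpha : G0 -> homeo X.

Definition distal : Prop :=
  forall x y, x != y ->
    0 < inf [set mdist (alpha g x) (alpha g y) | g in [set: G0]].

Definition free_points : set X := [set x | forall g, alpha g x = x -> g = 1%g].

Definition orbit_cocycle (phi : homeo X) (c : X -> discrete_topology G0) : Prop :=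
  continuous c /\ forall x, phi x = alpha (c x) x.

Definition full_group : set (homeo X) :=
  [set phi | exists c, orbit_cocycle phi c].

End Actions.

Section Delta.
Variables (R : realType) (cardT cardS l : nat) (eps : R).

Definition delta_den : R :=
  (1 + 2 * cardT%:R) * 2 ^+ l * cardT%:R ^+ 2 * (2 * cardS%:R).

Definition delta : R :=
  Num.min (eps / (delta_den * (cardS%:R + 2)))
          (1 - Num.sqrt (1 - eps / delta_den)).

(* Num.sqrt is total, so the condition on its argument is stated separately.
   When it holds for eps > 0 and cardT, cardS > 0, the first term of the minimum
   is at most 1/3, so that 0 < delta < 1 and ln delta / ln (1 - delta) makes
   sense and is at least 1. *)
Definition delta_defined : Prop := 0 <= 1 - eps / delta_den.

End Delta.

(* Main.v *)
Require Import Defs.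
From mathcomp Require Import all_boot all_order all_algebra finmap.
From mathcomp Require Import all_classical all_reals all_analysis.
From mathcomp Require Import lra.

Set Implicit Arguments.
Unset Strict Implicit.
Unset Printing Implicit Defensive.

Import Order.TTheory GRing.Theory Num.Theory.
Import numFieldNormedType.Exports.

Local Open Scope fset_scope.
Local Open Scope classical_set_scope.
Local Open Scope ring_scope.

(** The action of a finitely generated group on a compact zero-dimensional
space is equicontinuous as soon as it is distal, so the group generated by [T]
acts on a finite clopen partition that controls it completely.

Write [E y z] when all cocycles of elements of [T] take the same values at [y]
and at [z], and let [agree n] be the relation of being [E]-related after the
action of every element of the ball of radius [n] in the group generated by
[S]. Some [agree n] is invariant under [S] ([agree_distal_stable]). Otherwise
compactness produces a pair [(u, v)] outside [E] and, for every [n], an element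
[q n] which carries [(u, v)] into [agree n]. A limit [p] of the maps [q n] in
the enveloping semigroup carries [(u, v)] into all the relations [agree n].
Distality gives a left inverse [r] of [p] in the enveloping semigroup
([distal_enveloping_inverse]): the closed semigroup of the maps [r \o p]
contains an idempotent ([ellis_numakura]), and a distal action has no idempotent
but the identity. As [r] is a limit of group elements, and these keep
[(p u, p v)] in [E], the pair [(u, v)] is in [E]: a contradiction.

Let [~] be the invariant relation and let [x i], for [i] in a finite type [I],
be free points that meet every class. On each class an element of the group
[Gam] generated by [T] acts as one group element, so [Gam] preserves [~], and
the stabilizer in [Gam] of a tuple [y : I -> X] is trivial if [y] meets every
class and its coordinates are in the orbits of the points [x i]
([diag_act_free]). Given a ball [B] of the group generated by [S] with
[|dB| <= d |B|], consider the tuples [(b_i x_(j i))_i], with [b_i] in [B], that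
meet every class. They can leave this set under [T] only if some [b_i] is in
[dB]. If [j] is such that [b x_(j k) ~ x_k] for a proportion at least [1 / |I|]
of the [b] in [B], a choice which the pigeonhole principle permits, then the
tuples that meet every class are a proportion at least [|I| ^ - |I|] of all
tuples, so their relative boundary is at most [|I| ^ (|I| + 1) d]. A Folner set
in a free action of [Gam] contains a copy of a Folner set of [Gam]
([folner_free_action]), whence a Folner set in [Gam] with at most [|B| ^ |I|]
elements ([folner_tuples]).

It remains to take [l = |I| ^ (|I| + 1) + |I|]. The factor [2 ^ l] in the
denominators of [delta] absorbs the constant [|I| ^ (|I| + 1)] and the exponent
[l] absorbs [|I|]. Moreover [delta <= 1 / 3] makes the number of steps of the
recursion at least two, so that [Psi] is the volume of a ball whose Folner
constant is at most [delta]. The radii in the recursion exist by subexponential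
growth ([folner_radiusP]). The density of the free points makes the cocycles
unique, so [l] does not depend on their choice. *)

(** * Balls, growth and the explicit bounds *)

Section Balls.
Variables (G : groupType) (S : {fset G}).

Lemma ball_cayleyP n g : reflect
  (g \in ball_cayley S n \/
   exists s h, [/\ s \in S, h \in ball_cayley S n & g = (s * h)%g])
  (g \in ball_cayley S n.+1).
Proof.
rewrite /= in_fsetU.
apply: (iffP orP) => [[|/imfset2P[s sS [h hB ->]]]|[|[s [h [sS hB ->]]]]].
- by left.
- by right; exists s, h.
- by left.
- by right; apply/imfset2P; exists s => //; exists h.
Qed.

Lemma ball_cayley1 n : 1%g \in ball_cayley S n.
Proof.
by elim: n => [|n IH]; [exact: fset11|apply/ball_cayleyP; left].
Qed.

Lemma ball_cayley_leq m n : (m <= n)%N ->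
  {subset ball_cayley S m <= ball_cayley S n}.
Proof.
move=> /subnK <-; elim: (n - m)%N => // k IH g /IH gB.
by apply/ball_cayleyP; left.
Qed.

Lemma ball_cayley_gen s : s \in S -> s \in ball_cayley S 1.
Proof.
move=> sS; apply/ball_cayleyP; right; exists s, 1%g.
by rewrite mulg1; split=> //; exact: ball_cayley1.
Qed.

(** The balls are defined by multiplication on the left, so this
also lets generators be added on the right. *)
Lemma ball_cayleyM m n g h : g \in ball_cayley S m -> h \in ball_cayley S n ->
  (g * h)%g \in ball_cayley S (m + n).
Proof.
move=> + hB; elim: m g => [|m IH] g; first by move=> /fset1P ->; rewrite mul1g.
move=> /ball_cayleyP[/IH gB|[s [k [sS /IH kB ->]]]].
  exact: ball_cayley_leq gB.
by rewrite addSn -mulgA; apply/ball_cayleyP; right; exists s, (k * h)%g.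
Qed.

Hypothesis S_sym : symmetric_fset S.

Lemma ball_cayleyV n g : g \in ball_cayley S n -> (g^-1)%g \in ball_cayley S n.
Proof.
elim: n g => [|n IH] g; first by move=> /fset1P ->; rewrite invg1 fset11.
move=> /ball_cayleyP[/IH gB|[s [k [sS /IH kB ->]]]].
  exact: ball_cayley_leq gB.
rewrite invgM -addn1; apply: ball_cayleyM => //.
by apply: ball_cayley_gen; exact: S_sym.
Qed.

End Balls.

Section Growth.
Variables (R : realType) (G : groupType).
Implicit Types (S : {fset G}) (eps : R).

Lemma leastP (P : set nat) : P !=set0 -> P (least P).
Proof.
move=> [n Pn]; rewrite /least; case: xgetP => [m _ []//|noleast].
have ex : exists m, `[< P m >] by exists n; exact/asboolP.
case: (ex_minnP ex) => m /asboolP Pm mmin; case: (noleast m); split=> // k Pk.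
by apply: mmin; exact/asboolP.
Qed.

Lemma generated_subgroup S : subgroup (generated S).
Proof.
split; first by move=> H [[]].
by move=> x y Sx Sy H [Hg SH]; apply: Hg.2; [exact: Sx|exact: Sy].
Qed.

Lemma Vol_gt0 S n : (0 < Vol S n)%N.
Proof. by rewrite cardfs_gt0; apply/fset0Pn; exists 1%g; exact: ball_cayley1. Qed.

Lemma inner_boundary_sub (S F : {fset G}) : (inner_boundary S F `<=` F)%fset.
Proof. by apply/fsubsetP => g; rewrite !inE => /andP[]. Qed.

Lemma inner_boundaryPn (S F : {fset G}) g s :
  g \in F -> g \notin inner_boundary S F -> s \in S -> (s * g)%g \in F.
Proof.
move=> gF; rewrite !inE gF /= negbK => /fsubsetP SgF sS.
by apply: SgF; apply/imfsetP; exists s.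
Qed.

(** The ball of radius [n] lies in the interior of the ball of
radius [n + 1]. *)
Lemma Vol_inner_boundary S n :
  (#|` inner_boundary S (ball_cayley S n.+1)| + Vol S n <= Vol S n.+1)%N.
Proof.
rewrite /Vol -cardfsUI.
have -> : (inner_boundary S (ball_cayley S n.+1) `&` ball_cayley S n = fset0)%fset.
  apply/eqP; rewrite -fsubset0; apply/fsubsetP => g.
  rewrite in_fsetI => /andP[+ gB]; rewrite !inE => /andP[_ /negP[]].
  apply/fsubsetP => _ /imfsetP[s sS ->].
  by apply/ball_cayleyP; right; exists s, g.
rewrite cardfs0 addn0; apply: fsubset_leq_card.
by rewrite fsubUset inner_boundary_sub; apply: fsubsetUl.
Qed.

(** If no radius were admissible, each ball would be larger than the
previous one by the factor [1 / (1 - eps)], which contradicts subexponential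
growth. *)
Lemma folner_radiusP S eps : local_subexponential_growth R G ->
  symmetric_fset S -> 0 < eps ->
  #|` inner_boundary S (ball_cayley S (folner_radius S eps))|%:R
    <= eps * (Vol S (folner_radius S eps))%:R.
Proof.
move=> growth S_sym eps0; rewrite /folner_radius.
set P := (X in least X); suff /leastP[] : P !=set0 by [].
apply: contrapT => noradius.
have bad n : eps * (Vol S n.+1)%:R <
    #|` inner_boundary S (ball_cayley S n.+1)|%:R.
  by rewrite ltNge; apply/negP => ok; apply: noradius; exists n.+1.
pose a := 1 - eps.
have step n : (Vol S n)%:R <= a * (Vol S n.+1)%:R.
  have := Vol_inner_boundary S n; rewrite -(ler_nat R) natrD => le1.
  by have := bad n; rewrite /a mulrBl mul1r; lra.
have a_gt0 : 0 < a.
  have := step 0%N; have : 0 < (Vol S 0)%:R :> R by rewrite ltr0n Vol_gt0.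
  move=> V0 /(lt_le_trans V0); rewrite pmulr_lgt0 // ltr0n; exact: Vol_gt0.
have grow n : (a^-1) ^+ n <= (Vol S n)%:R.
  elim: n => [|n IH]; first by rewrite expr0 ler1n Vol_gt0.
  rewrite exprS ler_pdivrMl //; exact: le_trans (step n).
have a1 : 1 < a^-1 by rewrite invf_gt1 // /a ltrBlDr ltrDl.
have gen_growth : subexponential_growth R (generated S).
  by apply: growth; [exact: generated_subgroup|exists S].
have : \forall n \near \oo, (Vol S n)%:R `^ (n%:R^-1) < a^-1.
  by move: (gen_growth S S_sym erefl) => /cvgr_lt; apply.
have aV0 : 0 <= a^-1 by rewrite invr_ge0 ltW.
case=> N _ /(_ N.+1 (leqnSn N)) /=; rewrite ltNge => /negP; apply.
have -> : a^-1 = (a^-1 ^+ N.+1) `^ (N.+1%:R^-1).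
  by rewrite -powR_mulrn // -powRrM divff // powRr1.
by apply: ge0_ler_powR; rewrite ?nnegrE ?invr_ge0 ?exprn_ge0 ?grow.
Qed.

End Growth.

(** One step of the recursion suffices: its Folner constant is [d]
divided by a number that is at least 1. *)
Lemma Psi_succ (R : realType) (G : groupType) (S : {fset G}) (d : R) (m : nat) :
  (1 < m)%N -> 0 < d ->
  exists2 d' : R, 0 < d' <= d & Psi S d m = Vol S (folner_radius S d').
Proof.
case: m => [|[|m]] // _ d0.
pose p := 16 * (Psi_rec S d m)%:R ^+ 3 * (#|` S|%:R + 1) : R.
exists (d / p); last by [].
have Psi1 : 1 <= (Psi_rec S d m)%:R :> R.
  by rewrite ler1n; case: m {p} => [|m]; exact: Vol_gt0.
have p1 : 1 <= p.
  rewrite /p -mulrA; apply: mulr_ege1; first by lra.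
  apply: mulr_ege1; first by rewrite exprn_ege1.
  by rewrite lerDr.
have p0 : 0 < p by exact: lt_le_trans p1.
by rewrite divr_gt0 //= ler_pdivrMr // ler_peMr // ltW.
Qed.

Section DeltaBounds.
Variables (R : realType) (t s l : nat) (eps : R).
Hypotheses (t_gt0 : (0 < t)%N) (s_gt0 : (0 < s)%N) (eps_gt0 : 0 < eps).
Hypothesis delta_ok : delta_defined t s l eps.

Let d := delta t s l eps.

Lemma delta_den_ge : 2 ^+ l <= delta_den R t s l.
Proof.
have t1 : 1 <= t%:R :> R by rewrite ler1n.
have s1 : 1 <= s%:R :> R by rewrite ler1n.
have l0 : 0 < 2 ^+ l :> R by rewrite exprn_gt0.
rewrite /delta_den [_ * 2 ^+ l]mulrC -2!mulrA ler_peMr //.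
have t2 : 1 <= t%:R ^+ 2 :> R by rewrite exprn_ege1.
apply: mulr_ege1; first by lra.
by apply: mulr_ege1 => //; lra.
Qed.

Lemma delta_gt0 : 0 < d.
Proof.
have den0 : 0 < delta_den R t s l by rewrite (lt_le_trans _ delta_den_ge).
rewrite /d /delta lt_min; apply/andP; split.
  by rewrite divr_gt0 // mulr_gt0 // ltr_wpDl.
rewrite subr_gt0 -[ltRHS]sqrtr1 ltr_sqrt // ltrBlDr ltrDl divr_gt0 //.
Qed.

Lemma delta_le : 3 * d <= eps / delta_den R t s l.
Proof.
have den0 : 0 < delta_den R t s l by rewrite (lt_le_trans _ delta_den_ge).
have s1 : 1 <= s%:R :> R by rewrite ler1n.
have d1 : d <= eps / (delta_den R t s l * (s%:R + 2)) by rewrite ge_min lexx.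
apply: le_trans (ler_wpM2l _ d1) _ => //.
rewrite invfM [eps * _]mulrA mulrCA ler_piMr //.
  by rewrite divr_ge0 // ltW.
by rewrite ler_pdivrMr; lra.
Qed.

Lemma delta_le_third : 3 * d <= 1.
Proof. by apply: le_trans delta_le _; rewrite -subr_ge0; exact: delta_ok. Qed.

(** The first term of the minimum already contains the factor
[2 ^ l] in its denominator. *)
Lemma delta_pow : 2 ^+ l * d <= eps.
Proof.
have den0 : 0 < delta_den R t s l by rewrite (lt_le_trans _ delta_den_ge).
have := delta_le; rewrite ler_pdivlMr // => le1.
apply: le_trans le1; rewrite mulrC; apply: ler_pM.
- exact/ltW/delta_gt0.
- exact: exprn_ge0.
- by have := delta_gt0; lra.
- exact: delta_den_ge.
Qed.

(** Since [d <= 1 / 3], the number [d] is below [1 - d], so the ratio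
of the logarithms exceeds 1. *)
Lemma delta_steps : (1 < `|Num.ceil (ln d / ln (1 - d))|)%N.
Proof.
have d0 := delta_gt0; have d3 := delta_le_third.
have lt1 : ln (1 - d) < 0 by rewrite ln_lt0 //; lra.
have lt2 : ln d < ln (1 - d) by rewrite ltr_ln ?posrE; lra.
have : 1 < ln d / ln (1 - d) by rewrite ltr_ndivlMr // mul1r.
rewrite -[1]/(1%:~R) -ceil_gt_int.
by case: (Num.ceil _) => // n.
Qed.

End DeltaBounds.

(** * The enveloping semigroup of a distal action *)

(** Stated for an arbitrary chain because it serves both the chains of
subsemigroups in Zorn's lemma and decreasing sequences of closed sets. *)
Lemma compact_chain_nonempty (T : topologicalType) (F : set (set T)) :
  compact [set: T] -> F !=set0 -> total_on F subset ->
  (forall A, F A -> closed A /\ A !=set0) -> \bigcap_(A in F) A !=set0.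
Proof.
move=> cT F0 totF FP.
have ffF : ProperFilter (filter_from F id).
  apply: filter_from_proper; last by move=> A /FP[].
  apply: filter_from_filter => // A B FA FB.
  have [AB|BA] := totF _ _ FA FB.
    by exists A => // x Ax; split=> //; exact: AB.
  by exists B => // x Bx; split=> //; exact: BA.
have [|x [_ clx]] := cT _ ffF; first exact: filterT.
exists x => A FA; apply: (FP A FA).1 => U Ux.
by apply: (clx A U _ Ux); exists A.
Qed.

(** In a minimal closed subsemigroup [K] and for [x] in [K], both
[K x] and the set of the [q] in [K] with [q x = x] are closed subsemigroups of
[K], hence equal to [K]. The second equality gives [x x = x]. The form of
the continuity hypothesis is the one that holds for composition of self-maps in
the topology of pointwise convergence. *)
Lemma ellis_numakura (T : topologicalType) (op : T -> T -> T) (E : set T) :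
  hausdorff_space T -> compact [set: T] -> associative op ->
  (forall y, continuous (op^~ y)) ->
  closed E -> E !=set0 -> (forall x y, E x -> E y -> E (op x y)) ->
  exists2 e, E e & op e e = e.
Proof.
move=> hT cT opA opc cE E0 EM.
pose sub K := [/\ closed K, K !=set0 & forall x y, K x -> K y -> K (op x y)].
(* Zorn's lemma provides maximal sets, so it is applied to the
   complements in E of the closed subsemigroups. *)
have [A [sK Amax]] : exists A, sub (E `\` A) /\
    forall B, A `<` B -> ~ sub (E `\` B).
  apply: (@Zorn_bigcup _ [set A | sub (E `\` A)]) => F FP totF.
  have [->|/set0P F0] := eqVneq F set0.
    by rewrite /= /sub bigcup_set0 setD0.
  have FE A x : (E `\` \bigcup_(X in F) X) x -> F A -> (E `\` A) x.
    by move=> [Ex Fx] FA; split=> // Ax; apply: Fx; exists A.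
  have EF x : (forall A, F A -> (E `\` A) x) -> (E `\` \bigcup_(X in F) X) x.
    move=> FEx; have [A0 FA0] := F0; split; first by case: (FEx _ FA0).
    by move=> [A FA Ax]; case: (FEx _ FA).
  have EDE : E `\` \bigcup_(X in F) X = \bigcap_(A in F) (E `\` A).
    by apply/seteqP; split=> x; [move=> Ex A FA; exact: FE|move=> Fx; exact: EF].
  split.
  - by rewrite EDE; apply: closed_bigI => A /FP[].
  - rewrite EDE -(bigcap_image F (fun A => E `\` A) id).
    apply: compact_chain_nonempty => //.
    + by have [A FA] := F0; exists (E `\` A); exists A.
    + move=> _ _ [A FA <-] [B FB <-].
      by have [AB|BA] := totF _ _ FA FB; [right|left]; exact: setDS.
    + by move=> _ [A /FP[? ? ?] <-].
  - move=> x y Fx Fy; apply: EF => A FA.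
    by have [_ _] := FP _ FA; apply; exact: FE.
set K := E `\` A in sK.
have Kmin L : L `<=` K -> sub L -> L = K.
  move=> LK sL; apply/seteqP; split=> // x Kx; apply: contrapT => nLx.
  have EL : E `\` (~` L) = L.
    apply/seteqP; split=> [y [_ /contrapT]//|y Ly]; split; last exact.
    by case: (LK _ Ly).
  apply: (Amax (~` L)); last by rewrite EL.
  split=> [y Ay /LK[]//|LA]; apply: (Kx.2); exact: LA.
have [cK [x Kx] KM] := sK.
have Kcl : compact K by exact: subclosed_compact cK cT _.
have KxE : op^~ x @` K = K.
  apply: Kmin => [_ [y Ky <-]|]; first exact: KM.
  split.
  - apply: compact_closed => //; apply: continuous_compact => //.
    by apply: continuous_subspaceT => y; exact: opc.
  - by exists (op x x); exists x.
  - move=> _ _ [y Ky <-] [z Kz <-]; exists (op (op y x) z); last by rewrite !opA.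
    by apply: (KM) => //; apply: KM.
have [q Kq qx] : (op^~ x @` K) x by rewrite KxE.
have LE : K `&` [set q | op q x = x] = K.
  apply: Kmin; first exact: subIsetl.
  split.
  - apply: closedI => //.
    have -> : [set q | op q x = x] = op^~ x @^-1` [set x] by [].
    apply: preimage_closed; first by move=> y _; exact: opc.
    exact/accessible_closed_set1/hausdorff_accessible.
  - by exists q.
  - by move=> y z [Ky yx] [Kz zx]; split; [exact: KM|rewrite /= -opA zx yx].
exists x; first by case: Kx.
by have [] : (K `&` [set q | op q x = x]) x by rewrite LE.
Qed.

Section Enveloping.
Variables (R : realType) (X : metricType R) (G0 : groupType).
Variable alpha : UMagmaMorphism.type G0 (homeo X).
Variable H : set G0.

(** The Ellis semigroup of the action of [H], in the topology of
pointwise convergence. *)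
Definition enveloping : set {ptws X -> X} :=
  closure [set (homeo_fun (alpha g) : {ptws X -> X}) | g in H].

Lemma actM g h x : alpha (g * h)%g x = alpha g (alpha h x).
Proof. by rewrite gmulfM. Qed.

Lemma act1 x : alpha 1%g x = x.
Proof. by rewrite gmulf1. Qed.

Lemma actK g x : alpha (g^-1)%g (alpha g x) = x.
Proof. by rewrite -actM mulVg act1. Qed.

Lemma actVK g x : alpha g (alpha (g^-1)%g x) = x.
Proof. by rewrite -actM mulgV act1. Qed.

Hypothesis HM : forall g h, H g -> H h -> H (g * h)%g.

Lemma enveloping_act g : H g -> enveloping (homeo_fun (alpha g)).
Proof. by move=> Hg; apply: subset_closure; exists g. Qed.

Lemma eval_continuous (x : X) : continuous ((fun f => f x) : {ptws X -> X} -> X).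
Proof. exact: (@proj_continuous X (fun=> X) x). Qed.

Lemma ptws_compact : compact [set: X] -> compact [set: {ptws X -> X}].
Proof.
move=> cX; have := @tychonoff X (fun=> X) (fun=> setT) (fun=> cX).
by congr (compact _); apply/seteqP; split.
Qed.

Lemma into_ptws_continuous (Z : topologicalType) (F : Z -> {ptws X -> X}) :
  (forall x, continuous (fun z => F z x)) -> continuous F.
Proof. by move=> Fc z; apply/pointwise_cvgP => x; exact: Fc. Qed.

Lemma enveloping_sub (C : set {ptws X -> X}) :
  closed C -> (forall g, H g -> C (homeo_fun (alpha g))) -> enveloping `<=` C.
Proof.
move=> cC gC; apply: subset_trans cC; apply: closure_subset.
by move=> _ [g Hg <-]; exact: gC.
Qed.

(** Composition is continuous in its left argument, but in its right
argument only if the left one is continuous. So the limit is taken first over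
[q], with a group element on the left, and then over [p]. *)
Lemma enveloping_comp (p q : {ptws X -> X}) :
  enveloping p -> enveloping q -> enveloping (p \o q : {ptws X -> X}).
Proof.
move=> Ep Eq.
pose rcomp (f : {ptws X -> X}) : {ptws X -> X} := f \o q.
suff /(_ p Ep) : enveloping `<=` rcomp @^-1` enveloping by [].
apply: enveloping_sub.
  apply: preimage_closed; last exact: closed_closure.
  by move=> f _; apply: into_ptws_continuous => x; exact: eval_continuous.
move=> g Hg /=; pose lcomp (f : {ptws X -> X}) : {ptws X -> X} := alpha g \o f.
suff /(_ q Eq) : enveloping `<=` lcomp @^-1` enveloping by [].
apply: enveloping_sub.
  apply: preimage_closed; last exact: closed_closure.
  move=> f _; apply: into_ptws_continuous => x.
  move=> h; apply: (@continuous_comp _ _ _ (fun f : {ptws X -> X} => f x)).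
    exact: eval_continuous.
  exact: homeo_continuous.
move=> h Hh /=; have -> : lcomp (alpha h) = alpha (g * h)%g :> (X -> X).
  by apply: funext => x; rewrite actM.
by apply: enveloping_act; exact: HM.
Qed.

Hypothesis alpha_distal : distal alpha.

(** The points [x] and [e x] have the same image under [e], so group
elements near [e] bring them arbitrarily close to each other. *)
Lemma distal_idempotent (e : {ptws X -> X}) :
  enveloping e -> e \o e = e -> e = id.
Proof.
move=> Ee ee; apply: funext => x; apply/eqP; apply: contrapT => /negP.
rewrite eq_sym => xe; have := alpha_distal xe; set d := inf _ => d0.
have dle g : d <= mdist (alpha g x) (alpha g (e x)).
  apply: ge_inf; last by exists g.
  by exists 0 => _ [h _ <-]; exact: mdist_ge0.
have d2 : 0 < d / 2 by rewrite divr_gt0.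
have ne y : nbhs e [set f : {ptws X -> X} | ball (e y) (d / 2) (f y)].
  by apply: (@eval_continuous y e); exact: nbhsx_ballx.
have [f [[g _ <-]]] := Ee _ (filterI (ne x) (ne (e x))).
have eex : e (e x) = e x by rewrite -[in RHS]ee.
rewrite eex => -[/= b1 b2].
have := ball_triangle (ball_sym b1) b2.
by rewrite ballEmdist /= -splitr ltNge dle.
Qed.

(** The left ideal [E p] of the enveloping semigroup [E] is a
closed semigroup, and an idempotent in it is the identity. *)
Lemma distal_enveloping_inverse (p : {ptws X -> X}) :
  compact [set: X] -> enveloping p -> exists2 q, enveloping q & q \o p = id.
Proof.
move=> cX Ep.
have cT := ptws_compact cX.
have hT : hausdorff_space {ptws X -> X}.
  by apply: (@hausdorff_product X (fun=> X)) => x; exact: metric_hausdorff.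
have compc (y : {ptws X -> X}) :
    continuous ((fun f => f \o y) : {ptws X -> X} -> {ptws X -> X}).
  by apply: into_ptws_continuous => x; exact: eval_continuous.
pose L : set {ptws X -> X} := [set q \o p | q in enveloping].
have [||||_ [q Eq <-] qpi] := @ellis_numakura {ptws X -> X}
  (fun f g => f \o g) L hT cT _ compc.
- by move=> f g h.
- apply: compact_closed => //; apply: continuous_compact.
    by apply: continuous_subspaceT => y; exact: compc.
  by apply: subclosed_compact cT _ => //; exact: closed_closure.
- by exists (p \o p); exists p.
- move=> _ _ [q Eq <-] [r Er <-]; exists (q \o p \o r) => //.
  by apply: enveloping_comp => //; exact: enveloping_comp.
exists q => //; apply: distal_idempotent => //; exact: enveloping_comp.
Qed.

End Enveloping.

(** * An invariant clopen relation *)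

Lemma clopen_forall_fset (K : choiceType) (Z : topologicalType) (A : {fset K})
    (P : K -> set Z) :
  (forall k, k \in A -> clopen (P k)) ->
  clopen [set z | forall k, k \in A -> P k z].
Proof.
move=> Pcl.
have -> : [set z | forall k, k \in A -> P k z] = \bigcap_(k in [set` A]) P k by [].
split; last by apply: closed_bigI => k kA; exact: (Pcl k kA).2.
rewrite bigcap_fset big_seq; elim/big_ind: _ => //; first exact: openT.
  exact: openI.
by move=> k kA; exact: (Pcl k kA).1.
Qed.

Section InvariantRelation.
Variables (R : realType) (X : metricType R) (G0 : groupType).
Variable alpha : UMagmaMorphism.type G0 (homeo X).
Variables (S : {fset G0}) (E : X -> X -> Prop).
Hypotheses (X_compact : compact [set: X]) (alpha_distal : distal alpha).
Hypothesis (S_sym : symmetric_fset S).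
Hypothesis E_clopen : clopen [set u : X * X | E u.1 u.2].

Definition agree n x y : Prop :=
  forall g, g \in ball_cayley S n -> E (alpha g x) (alpha g y).

Lemma agree_leq m n x y : (m <= n)%N -> agree n x y -> agree m x y.
Proof. by move=> mn Exy g /(ball_cayley_leq mn); exact: Exy. Qed.

Lemma agree_step n s x y :
  s \in S -> agree n.+1 x y -> agree n (alpha s x) (alpha s y).
Proof.
move=> sS Exy g gB; rewrite -!actM; apply: Exy; rewrite -addn1.
by apply: ball_cayleyM => //; exact: ball_cayley_gen.
Qed.

Lemma pair_act_continuous g :
  continuous (fun u : X * X => (alpha g u.1, alpha g u.2)).
Proof.
move=> u; apply: cvg_pair; apply: continuous_comp.
- exact: cvg_fst.
- exact: homeo_continuous.
- exact: cvg_snd.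
- exact: homeo_continuous.
Qed.

Lemma agree_clopen n : clopen [set u : X * X | agree n u.1 u.2].
Proof.
apply: (clopen_forall_fset (P := fun g =>
  (fun u : X * X => (alpha g u.1, alpha g u.2)) @^-1` [set u | E u.1 u.2])).
by move=> g _; apply: preimage_clopen => //; exact: pair_act_continuous.
Qed.

(** If no relation [agree n] were stable, the closed sets [D n] of
pairs outside [E] that an element of the ball of radius [n + 1] carries into
[agree n] would be nonempty and decreasing. A pair [(u, v)] in all of them would
be carried by some [p] in the enveloping semigroup into every [agree n]. The
left inverse of [p] carries it back, and is a limit of group elements that keep
[(p u, p v)] in the closed relation [E]. *)
Lemma agree_distal_stable :
  exists n, forall x y, agree n x y -> agree n.+1 x y.
Proof.
apply: contrapT => /forallNP nstable.
pose D n : set (X * X) := [set u | ~ E u.1 u.2 /\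
  exists2 q, q \in ball_cayley S n.+1 & agree n (alpha q u.1) (alpha q u.2)].
(* If [x] and [y] agree up to radius [n] but are separated by [g] in the
   next ball, then [g^-1] carries the separated pair back into [agree n]. *)
have D_ne n : D n !=set0.
  have /existsNP[x /existsNP[y /not_implyP[Exy]]] := nstable n.
  move=> /existsNP[g /not_implyP[gB nE]].
  exists (alpha g x, alpha g y); split=> //; exists (g^-1)%g.
    exact: ball_cayleyV.
  by rewrite /= !actK.
have D_closed n : closed (D n).
  apply: closedI.
    have -> : (fun u : X * X => ~ E u.1 u.2) = ~` [set u | E u.1 u.2] by [].
    by apply: open_closedC; exact: E_clopen.1.
  have -> : (fun u : X * X => exists2 q, q \in ball_cayley S n.+1 &
      agree n (alpha q u.1) (alpha q u.2)) =
    \bigcup_(q in [set` ball_cayley S n.+1])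
      (fun u : X * X => (alpha q u.1, alpha q u.2)) @^-1`
        [set u | agree n u.1 u.2].
    by apply/seteqP; split=> u [q qB uq]; exists q.
  apply: closed_bigcup => // q _.
  by apply: preimage_closed; [move=> ? _; exact: pair_act_continuous|
    exact: (agree_clopen n).2].
have D_decr n : D n.+1 `<=` D n.
  move=> u [nE [q /ball_cayleyP[qB|[s [h [sS hB qE]]]] uq]].
    by split=> //; exists q => //; exact: agree_leq uq.
  split=> //; exists h => //.
  by have := agree_step (S_sym sS) uq; rewrite qE !actM !actK.
have D_decrn m n : (m <= n)%N -> D n `<=` D m.
  by move=> /subnK <-; elim: (n - m)%N => // k IH u /D_decr; exact: IH.
have [[u v] uvD] : \bigcap_(A in range D) A !=set0.
  apply: compact_chain_nonempty.
  - by rewrite -setXTT; exact: compact_setX.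
  - by exists (D 0%N); exists 0%N.
  - move=> _ _ [m _ <-] [n _ <-].
    by case/orP: (leq_total m n) => /D_decrn; [right|left].
  - by move=> _ [n _ <-].
have {}uvD n : D n (u, v) by apply: uvD; exists n.
have nEuv : ~ E u v by case: (uvD 0%N).
have /choice[q qP] : forall n, exists q, q \in ball_cayley S n.+1 /\
  agree n (alpha q u) (alpha q v).
  by move=> n; have [_ [q]] := uvD n; exists q.
pose H : set G0 := [set g | exists n, g \in ball_cayley S n].
have HM g h : H g -> H h -> H (g * h)%g.
  by move=> [m gB] [n hB]; exists (m + n)%N; exact: ball_cayleyM.
pose F := (fun n => homeo_fun (alpha (q n)) : {ptws X -> X}) @ \oo.
have FF : ProperFilter F by exact: fmap_proper_filter.
have [|p [_ pF]] := ptws_compact X_compact FF; first exact: filterT.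
(* The cluster point p lies in every closed set that contains the maps
   [q n] from some index on. *)
have inF (C : set {ptws X -> X}) j : closed C ->
    (forall n, (j <= n)%N -> C (homeo_fun (alpha (q n)))) -> C p.
  move=> cC jC; apply: cC => U Up; apply: pF => //.
  by exists j => // n; exact: jC.
have pair_eval_continuous a b :
    continuous (fun f : {ptws X -> X} => (f a, f b)).
  move=> f; apply: (@cvg_pair _ _ _ (nbhs f) (nbhs (f a)) (nbhs (f b))).
    exact: (@eval_continuous _ _ a f).
  exact: (@eval_continuous _ _ b f).
have Ep : enveloping alpha H p.
  apply: (inF _ 0%N) => [|n _]; first exact: closed_closure.
  by apply: enveloping_act; exists n.+1; case: (qP n).
have puv n : agree n (p u) (p v).
  apply: (inF [set f | agree n (f u) (f v)] n); last first.
    by move=> k nk; apply: agree_leq nk _; case: (qP k).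
  have -> : [set f : {ptws X -> X} | agree n (f u) (f v)] =
    (fun f : {ptws X -> X} => (f u, f v)) @^-1` [set w | agree n w.1 w.2] by [].
  by apply: preimage_closed; [move=> ? _; exact: pair_eval_continuous|
    exact: (agree_clopen n).2].
have [r Er rp] := distal_enveloping_inverse HM alpha_distal X_compact Ep.
apply: nEuv; have -> : u = r (p u) by rewrite -[LHS]/(id u) -rp.
have -> : v = r (p v) by rewrite -[LHS]/(id v) -rp.
apply: (enveloping_sub (C := [set f | E (f (p u)) (f (p v))]) _ _ Er).
  have -> : [set f : {ptws X -> X} | E (f (p u)) (f (p v))] =
    (fun f : {ptws X -> X} => (f (p u), f (p v))) @^-1` [set w | E w.1 w.2] by [].
  by apply: preimage_closed; [move=> ? _; exact: pair_eval_continuous|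
    exact: E_clopen.2].
by move=> g [n gB]; exact: puv gB.
Qed.

End InvariantRelation.

(** * Continuous cocycles and free points *)

(** Compactness as near covering, along the filter of the
families that contain a large enough finite set of indices. *)
Lemma compact_finite_nbhs_cover (T : topologicalType) (U : T -> set T) :
  compact [set: T] -> (forall x, nbhs x (U x)) ->
  exists s : {fset T}, forall y, exists2 x, x \in s & U x y.
Proof.
move=> /compact_near_coveringP cT nU.
pose F : set_system {fset T} := [set A | exists s, forall t, (s `<=` t)%fset -> A t].
have FF : Filter F.
  split; first by exists fset0.
    move=> A B [s sA] [t tB]; exists (s `|` t)%fset => u.
    by rewrite fsubUset => /andP[su tu]; split; [exact: sA|exact: tB].
  by move=> A B AB [s sA]; exists s => t /sA /AB.
have [|s sU] := cT _ F (fun s y => exists2 x, x \in s & U x y) FF.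
  move=> x _; exists (U x, [set s : {fset T} | x \in s]) => /=.
    by split=> //; exists [fset x]%fset => t; rewrite fsub1set.
  by move=> [y s] [/= Uxy xs]; exists x.
by exists s => y; apply: (sU s).
Qed.

Section OpenClasses.
Variables (R : realType) (X : metricType R) (G0 : groupType).
Variable alpha : UMagmaMorphism.type G0 (homeo X).

Lemma discrete_pair_clopen (c : X -> discrete_topology G0) (P : G0 -> G0 -> Prop) :
  continuous c -> clopen [set u : X * X | P (c u.1) (c u.2)].
Proof.
move=> cc; have oP Q : open [set u : X * X | Q (c u.1) (c u.2)].
  rewrite openE => -[x y] Qxy; rewrite /interior.
  have nc z : nbhs z (c @^-1` [set c z]) by apply: cc; exact: discrete_set1.
  exists (c @^-1` [set c x], c @^-1` [set c y]); first by split; exact: nc.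
  by move=> [z w] [/= -> ->].
by split; [exact: oP|rewrite -openC; exact: (oP (fun a b => ~ P a b))].
Qed.

(** The classes of [E] are open, so each contains a free point, and
finitely many of them cover the space. *)
Lemma free_representatives (E : X -> X -> Prop) :
  compact [set: X] -> dense (free_points alpha) ->
  clopen [set u : X * X | E u.1 u.2] ->
  (forall x, E x x) -> (forall x y, E x y -> E y x) ->
  exists (I : finType) (x : I -> X),
    (forall i, free_points alpha (x i)) /\ forall y, exists i, E (x i) y.
Proof.
move=> cX freed [oE _] Exx Esym.
have oclass x : open [set y | E x y].
  have -> : [set y | E x y] = (fun y => (x, y)) @^-1` [set u | E u.1 u.2] by [].
  apply: open_comp => // y _; apply: (@cvg_pair _ _ _ (nbhs y) (nbhs x) (nbhs y)).
    exact: cvg_cst.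
  exact: cvg_id.
have /choice[f fP] : forall x, exists z, free_points alpha z /\ E z x.
  move=> x; have [|z [Exz fz]] := freed _ _ (oclass x); first by exists x; exact: Exx.
  by exists z; split=> //; exact: Esym.
have [|s sP] := @compact_finite_nbhs_cover X (fun x => [set y | E (f x) y]) cX.
  by move=> x; apply: open_nbhs_nbhs; split; [exact: oclass|exact: (fP x).2].
exists s, (fun i => f (val i)); split=> [i|y]; first exact: (fP _).1.
by have [x xs Ey] := sP y; exists [` xs]%fset.
Qed.

(** Two cocycles that differ at a point take two constant distinct
values near it, and there the density provides a free point on which these
values act in the same way. *)
Lemma cocycle_unique (phi : homeo X) (c c' : X -> discrete_topology G0) :
  dense (free_points alpha) ->
  orbit_cocycle alpha phi c -> orbit_cocycle alpha phi c' -> c = c'.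
Proof.
move=> freed [cc phic] [cc' phic']; apply: funext => x; apply: contrapT => ncx.
pose O := (c @^-1` [set c x]) `&` (c' @^-1` [set c' x]).
have oO : open O.
  apply: openI; (apply: open_comp => [y _|]; last exact: discrete_open).
    exact: cc.
  exact: cc'.
have [|y [[/= cy c'y] fy]] := freed O _ oO; first by exists x.
have := phic' y; rewrite phic cy c'y => acc'.
have /mulg1_eq : ((c x)^-1 * c' x)%g = 1%g :> G0.
  by apply: fy; rewrite actM -acc' actK.
by rewrite invgK => /ncx.
Qed.

End OpenClasses.

(** * Folner sets in free actions *)

(** Unlike [inE], this keeps the predicate [P] folded when it is
the boolean value of a proposition. *)
Lemma in_sep (Y : choiceType) (F : {fset Y}) (P : pred Y) z :
  (z \in [fset x in F | P x]) = (z \in F) && P z.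
Proof. by rewrite !inE. Qed.

(** If every class had a proportion of elements satisfying [D]
greater than [eps], so would [F]. The induction removes a class with too large a
proportion, which lowers the proportion on the rest. *)
Lemma class_average (R : realDomainType) (Y : choiceType) (e : rel Y)
    (D : pred Y) (eps : R) (F : {fset Y}) :
  equivalence_rel e -> F != fset0 ->
  #|` [fset z in F | D z]|%:R <= eps * #|` F|%:R ->
  exists2 y, y \in F &
    #|` [fset z in F | e y z && D z]|%:R <= eps * #|` [fset z in F | e y z]|%:R.
Proof.
move=> e_equiv; have exx x : e x x by case: (e_equiv x x x).
have exy x y z : e x y -> e x z = e y z by case: (e_equiv x y z) => _; apply.
elim: {F}_.+1 {-2}F (ltnSn #|` F|) => // n IH F; rewrite ltnS => Fn F0 FD.
have /fset0Pn[y yF] := F0.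
have [?|bad] := leP (#|` [fset z in F | e y z && D z]|%:R : R)
  (eps * #|` [fset z in F | e y z]|%:R); first by exists y.
pose F' := [fset z in F | ~~ e y z]%fset.
have split_card (P : pred Y) : (#|` [fset z in F | P z]| =
    #|` [fset z in F | e y z && P z]| + #|` [fset z in F' | P z]|)%N.
  rewrite -[LHS](cardfsID [fset z in F | e y z]); congr (_ + _)%N;
    congr #|` _|; apply/fsetP => z; rewrite !inE;
    by case: (z \in F); case: (e y z); case: (P z).
have cF : (#|` F| = #|` [fset z in F | e y z]| + #|` F'|)%N.
  have := split_card predT.
  have -> : [fset z in F | predT z]%fset = F by apply/fsetP => z; rewrite !inE andbT.
  have -> : [fset z in F' | predT z]%fset = F' by apply/fsetP => z; rewrite !inE andbT.
  by move=> ->; congr (#|` _| + _)%N; apply/fsetP => z; rewrite !inE andbT.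
move: FD; rewrite split_card [in X in _ <= X]cF !natrD mulrDr => FD.
have F'D : #|` [fset z in F' | D z]|%:R < eps * #|` F'|%:R by lra.
have F'0 : F' != fset0.
  apply: contraTneq F'D => ->; rewrite cardfs0 mulr0 -leNgt ler0n //.
have [|x xF' xD] := IH F' _ F'0 (ltW F'D).
  apply: leq_trans Fn; rewrite cF -[ltnLHS]add0n ltn_add2r cardfs_gt0.
  by apply/fset0Pn; exists y; rewrite !inE yF exx.
move: xF'; rewrite !inE => /andP[xF nyx].
have F'x z : e x z -> ~~ e y z.
  by move=> xz; apply: contra nyx => yz; rewrite (exy _ _ _ yz) -(exy _ _ _ xz) exx.
exists x => //; move: xD.
have -> : [fset z in F' | e x z && D z]%fset = [fset z in F | e x z && D z]%fset.
  apply/fsetP => z; rewrite !inE; case: (boolP (e x z)) => [/F'x ->|_].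
    by rewrite andbT.
  by rewrite !andbF.
suff -> : [fset z in F' | e x z]%fset = [fset z in F | e x z]%fset by [].
apply/fsetP => z; rewrite !inE; case: (boolP (e x z)) => [/F'x ->|_].
  by rewrite andbT.
by rewrite !andbF.
Qed.

Section FreeAction.
Variables (R : realType) (Gam : groupType) (Y : choiceType).
Variable act : Gam -> Y -> Y.
Hypotheses (act1 : forall y, act 1%g y = y)
  (actM : forall g h y, act (g * h)%g y = act g (act h y)).

(** For the action of a group on itself by left multiplication this
is [inner_boundary]. *)
Definition act_boundary (T : {fset Gam}) (F : {fset Y}) : {fset Y} :=
  [fset y in F | ~~ ([fset act t y | t in T] `<=` F)%fset]%fset.

(** By averaging, the part [O] of [F] in some orbit has relative
boundary at most [eps]. Since the action is free on it, sending each point of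
[O] to the group element that carries a fixed base point to it identifies [O]
with a subset of the group, equivariantly. *)
Lemma folner_free_action (T : {fset Gam}) (F : {fset Y}) (eps : R) :
  F != fset0 ->
  (forall y g, y \in F -> generated T g -> act g y = y -> g = 1%g) ->
  #|` act_boundary T F|%:R <= eps * #|` F|%:R ->
  (folner T eps <= (#|` F|%:R)%:E)%E.
Proof.
move=> F0 free Fbd.
have [gen1 genV] := generated_subgroup T.
have genT t : t \in T -> generated T t by move=> tT H [_]; exact.
have gendiv g h : generated T g -> generated T h -> generated T (g / h)%g.
  exact: genV.
have geninv g : generated T g -> generated T (g^-1)%g.
  by move=> Tg; rewrite -div1g; exact: gendiv.
have genmul g h : generated T g -> generated T h -> generated T (g * h)%g.
  by move=> Tg Th; rewrite -[h]invgK; apply: gendiv => //; exact: geninv.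
pose e y z := `[< exists2 g, generated T g & act g y = z >].
have e_equiv : equivalence_rel e.
  apply/equivalence_relP; split=> [y|y z /asboolP[g Tg <-] w].
    by apply/asboolP; exists 1%g.
  apply/asboolP/asboolP => -[h Th <-].
    exists (h / g)%g; first exact: gendiv.
    by rewrite -actM -mulgA mulVg mulg1.
  by exists (h * g)%g; [exact: genmul|rewrite actM].
have [|y yF] := @class_average R Y e
    (fun z => ~~ ([fset act t z | t in T] `<=` F)%fset) eps F e_equiv F0.
  exact: Fbd.
set O := [fset z in F | e y z]%fset => Obd.
have /choice[h hP] : forall z, exists g, e y z -> generated T g /\ act g y = z.
  move=> z; have [/asboolP[g Tg gy]|nyz] := boolP (e y z); first by exists g.
  by exists 1%g.
have eO z : z \in O -> e y z by rewrite ?in_sep => /andP[].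
have h_inj : {in O &, injective h}.
  move=> z w /eO/hP[_ zE] /eO/hP[_ wE] hzw.
  by rewrite -zE -wE hzw.
have subOF z : z \in O -> z \in F by rewrite ?in_sep => /andP[].
pose FG := [fset h z | z in O].
have cFG : #|` FG| = #|` O| by rewrite card_in_imfset.
have cO : (#|` O| <= #|` F|)%N.
  by apply/fsubset_leq_card/fsubsetP => z /subOF.
apply: (@le_trans _ _ (#|` O|%:R)%:E); last by rewrite lee_fin ler_nat.
apply: ereal_inf_lbound; exists FG; last by rewrite cFG.
split.
- apply/fset0Pn; exists (h y); apply/imfsetP; exists y => //.
  by rewrite in_sep yF; have [-> _] := e_equiv y y y.
- by move=> _ /imfsetP[z /eO/hP[Tz _] ->].
rewrite cFG; apply: le_trans Obd; rewrite ler_nat.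
set D := [fset z in F | _ && _].
have -> : #|` D| = #|` [fset h z | z in D]|.
  rewrite [RHS]card_in_imfset // => z w.
  rewrite !in_sep => /andP[zF /andP[yz _]] /andP[wF /andP[yw _]].
  by apply: h_inj; rewrite in_sep ?zF ?wF.
apply/fsubset_leq_card/fsubsetP => g.
rewrite in_sep => /andP[/imfsetP[z /= zO ->] nsub].
apply/imfsetP; exists z => //=; move: (zO); rewrite !in_sep => /andP[zF yz].
rewrite zF yz /=; apply: contra nsub => /fsubsetP TzF.
apply/fsubsetP => _ /imfsetP[t /= tT ->].
have [Thz hzy] := hP _ yz.
have Ttz : generated T (t * h z)%g by apply: genmul => //; exact: genT.
have tzy : act (t * h z)%g y = act t z by rewrite actM hzy.
have ytz : e y (act t z) by apply/asboolP; exists (t * h z)%g.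
have tzF : act t z \in F by apply: TzF; apply/imfsetP; exists t.
apply/imfsetP; exists (act t z); first by rewrite /= ?in_sep tzF.
have [Thtz htzy] := hP _ ytz.
have /divg1_eq : ((t * h z) / h (act t z))%g = 1%g.
  apply: (free (act t z)) => //; first exact: gendiv.
  rewrite actM; suff -> : act (h (act t z))^-1%g (act t z) = y by [].
  by rewrite -{2}htzy -actM mulVg act1.
by [].
Qed.

End FreeAction.

(** * Counting tuples *)

Lemma pigeonhole_pred (I B : finType) (P : I -> pred B) :
  I -> (forall b, exists i, P i b) -> exists i, (#|B| <= #|I| * #|P i|)%N.
Proof.
move=> i0 BP; exists [arg max_(i > i0) #|P i|].
case: arg_maxnP => // i _ imax; rewrite -sum_nat_const.
apply: (@leq_trans (\sum_(j : I) #|P j|)); last by apply: leq_sum => j _; exact: imax.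
rewrite -sum1_card; under [leqRHS]eq_bigr => j _ do rewrite -sum1_card big_mkcond /=.
rewrite exchange_big /=; apply: leq_sum => b _.
have [j Pjb] := BP b.
by rewrite (bigD1 j) //= [_ \in _]Pjb.
Qed.

(** Multiplying by the cardinality of [B] avoids the exponent
[#|I| - 1] and the division. *)
Lemma card_ffun_coord (I B : finType) (D : pred B) (i : I) :
  (#|[pred f : {ffun I -> B} | D (f i)]| * #|B| = #|D| * #|B| ^ #|I|)%N.
Proof.
pose A j := if j == i then D else predT.
have -> : #|[pred f : {ffun I -> B} | D (f i)]| = #|family A|.
  apply: eq_card => f; rewrite !inE; apply/idP/familyP => [Df j|/(_ i)].
    by rewrite /A; case: eqP => [->|].
  by rewrite /A eqxx.
rewrite card_family.
have -> : foldr muln 1%N [seq #|A x| | x : I] = (\prod_(j : I) #|A j|)%N.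
  by rewrite foldrE big_map big_enum.
rewrite (bigD1 i) //= {1}/A eqxx -mulnA; congr (_ * _)%N.
rewrite (eq_bigr (fun=> #|B|)) => [|j ji]; last by rewrite /A (negbTE ji).
rewrite prod_nat_const -expnSr; congr (_ ^ _)%N.
by rewrite cardC1 prednK //; apply/card_gt0P; exists i.
Qed.

(** There are at most [|I| |D| |B| ^ (|I| - 1)] tuples with
a coordinate in [D], while [W] contains the product of the sets [C i], whose
cardinality is at least [(|B| / |I|) ^ |I|]. *)
Lemma card_bad_tuples (I B : finType) (D : pred B) (C : I -> pred B)
    (W : pred {ffun I -> B}) :
  (forall i, (#|B| <= #|I| * #|C i|)%N) ->
  (forall f : {ffun I -> B}, (forall i, C i (f i)) -> W f) ->
  (#|[pred f | W f && [exists i, D (f i)]]| * #|B| <=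
   #|I| ^ #|I|.+1 * #|D| * #|W|)%N.
Proof.
move=> BC CW.
have bad : (#|[pred f : {ffun I -> B} | W f && [exists i, D (f i)]]| <=
    \sum_(i : I) #|[pred f : {ffun I -> B} | D (f i)]|)%N.
  under eq_bigr => i _ do rewrite -sum1_card big_mkcond /=.
  rewrite exchange_big /= -sum1_card big_mkcond /=; apply: leq_sum => f _.
  rewrite inE; case: andP => // -[_ /existsP[i Di]].
  by rewrite (bigD1 i) //= inE Di.
apply: leq_trans (leq_mul bad (leqnn _)) _; rewrite big_distrl /=.
under eq_bigr => i _ do rewrite card_ffun_coord.
rewrite sum_nat_const expnS -!mulnA leq_mul2l; apply/orP; right.
rewrite [leqRHS]mulnCA leq_mul2l; apply/orP; right.
have CWc : (\prod_(i : I) #|C i| <= #|W|)%N.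
  apply: (@leq_trans #|family C|).
    by rewrite card_family foldrE big_map big_enum.
  apply: subset_leq_card; apply/fintype.subsetP => f /familyP Cf.
    by apply: CW => i; exact: Cf.
apply: leq_trans (leq_mul (leqnn _) CWc).
rewrite -!prod_nat_const -big_split /=; apply: leq_prod => i _; exact: BC.
Qed.

Lemma fset_imageP (K : finType) (Y : choiceType) (f : K -> Y) (W : pred K) y :
  reflect (exists2 k, W k & y = f k) (y \in [fset z in [seq f k | k in W]]).
Proof.
rewrite inE /=; apply: (iffP idP) => [/mapP[k]|[k Wk ->]].
  by rewrite mem_enum => Wk ->; exists k.
by apply/mapP; exists k; rewrite // mem_enum.
Qed.

Lemma card_fset_image (K : finType) (Y : choiceType) (f : K -> Y) (W : pred K) :
  injective f -> #|` [fset z in [seq f k | k in W]]| = #|W|.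
Proof.
by move=> f_inj; rewrite card_fseq undup_id ?size_image // map_inj_uniq ?enum_uniq.
Qed.

(** * Folner sets of tuples of points *)

Section FolnerBound.
Variables (R : realType) (X : metricType R) (G0 : groupType).
Variable alpha : UMagmaMorphism.type G0 (homeo X).
Variables (T : {fset homeo X}) (S : {fset G0}) (eqv : X -> X -> Prop).
Hypothesis T_sym : symmetric_fset T.
Hypotheses (eqv_trans : forall x y z, eqv x y -> eqv y z -> eqv x z)
  (eqv_act : forall s x y, s \in S -> eqv x y -> eqv (alpha s x) (alpha s y))
  (eqv_local : forall t x y, t \in T -> eqv x y ->
     exists s, [/\ s \in S, t x = alpha s x & t y = alpha s y]).
Variables (I : finType) (x : I -> X).
Hypotheses (x_free : forall i, free_points alpha (x i))
  (x_repr : forall y, exists i, eqv (x i) y).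

Lemma eqv_ball n g y z :
  g \in ball_cayley S n -> eqv y z -> eqv (alpha g y) (alpha g z).
Proof.
elim: n g => [|n IH] g; first by move=> /fset1P ->; rewrite !act1.
move=> /ball_cayleyP[/IH|[s [h [sS /IH hP ->]]]]; first exact.
by move=> /hP; rewrite !actM; exact: eqv_act.
Qed.

Lemma free_orbit_inj i g h : alpha g (x i) = alpha h (x i) -> g = h.
Proof.
move=> gh; rewrite -[g]invgK; apply: mulg1_eq.
by apply: (x_free (i := i)); rewrite actM -gh actK.
Qed.

(** The property of acting on pairs of related points as one group
element is stable under products because group elements preserve the relation.
It is required of [g^-1] as well in order to get a subgroup. *)
Lemma generated_local g y z : generated T g -> eqv y z ->
  exists n h, [/\ h \in ball_cayley S n, g y = alpha h y & g z = alpha h z].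
Proof.
pose loc (g : homeo X) := forall y z, eqv y z ->
  exists n h, [/\ h \in ball_cayley S n, g y = alpha h y & g z = alpha h z].
move=> Tg; suff [gloc _] : loc g /\ loc (g^-1)%g by exact: gloc.
have locM (f k : homeo X) : loc f -> loc k -> loc (f * k)%g.
  move=> floc kloc u v uv; have [n [h [hB hu hv]]] := kloc u v uv.
  have [m [h' [h'B hu' hv']]] := floc _ _ (eqv_ball hB uv).
  exists (m + n)%N, (h' * h)%g; rewrite !actM -hu' -hv' -hu -hv; split=> //.
  exact: ball_cayleyM.
apply: (Tg (fun g => loc g /\ loc (g^-1)%g)); split; last first.
  have locT t : t \in T -> loc t.
    move=> tT u v uv; have [s [sS su sv]] := eqv_local tT uv.
    by exists 1%N, s; split=> //; exact: ball_cayley_gen.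
  by move=> t tT; split; apply: locT => //; exact: T_sym.
split=> [|f k [floc f'loc] [kloc k'loc]].
  rewrite /= invg1; split=> u v _; exists 0%N, 1%g; rewrite !act1;
    by split=> //; exact: ball_cayley1.
by rewrite /= invgM invgK; split; exact: locM.
Qed.

Definition diag_act (g : homeo X) (y : {ffun I -> X}) : {ffun I -> X} :=
  [ffun i => g (y i)].

(** On the class of [z], the element [g] acts as some [h] in [G0],
which fixes the coordinate of the tuple in that class. That coordinate is a free
point, so [h = 1] and [g] fixes [z]. *)
Lemma diag_act_free (y : {ffun I -> X}) g :
  (forall k, exists i, eqv (y i) (x k)) ->
  (forall i, exists b k, y i = alpha b (x k)) ->
  generated T g -> diag_act g y = y -> g = 1%g.
Proof.
move=> y_hits y_orb Tg gy; apply: homeoP => z /=.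
have [k xkz] := x_repr z; have [i yixk] := y_hits k.
have [n [h [hB hy hz]]] := generated_local Tg (eqv_trans yixk xkz).
have hyi : alpha h (y i) = y i by rewrite -hy -[in RHS]gy ffunE.
have [b [j yE]] := y_orb i.
have hb : (h * b)%g = b by apply: (@free_orbit_inj j); rewrite actM -yE.
have h1 : h = 1%g by rewrite -(mulgK b h) hb mulgV.
by rewrite hz h1 act1.
Qed.

(** The Folner set consists of the tuples [b_i x_(j i)], with [b_i]
in the ball [B], that meet every class. The base points [x_(j i)] are chosen so
that these are a positive proportion of all tuples. *)
Lemma folner_tuples (r : nat) (d eps : R) :
  #|` inner_boundary S (ball_cayley S r)|%:R <= d * (Vol S r)%:R ->
  (#|I| ^ #|I|.+1)%:R * d <= eps ->
  (folner T eps <= ((Vol S r ^ #|I|)%N%:R)%:E)%E.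
Proof.
set B := ball_cayley S r => Bd deps.
have cB : #|{: B}| = Vol S r by rewrite -cardfE.
have V0 : (0 < Vol S r)%N := Vol_gt0 S r.
(* Each [b] in [B] permutes the classes, so it carries some [x j] into
   the class of [x k]; one index [j] works for a proportion 1 / |I| of [B]. *)
have /choice[j jP] : forall k, exists j,
    (#|{: B}| <= #|I| * #|[pred b : B | `[< eqv (alpha (val b) (x j)) (x k) >]]|)%N.
  move=> k; apply: pigeonhole_pred => // b.
  have [j xj] := x_repr (alpha (val b)^-1%g (x k)); exists j; apply/asboolP.
  by rewrite -[X in eqv _ X](actVK alpha (val b)); exact: eqv_ball (valP b) xj.
pose C k := [pred b : B | `[< eqv (alpha (val b) (x (j k))) (x k) >]].
pose D := [pred b : B | val b \in inner_boundary S B].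
pose tup (f : {ffun I -> B}) : {ffun I -> X} :=
  [ffun i => alpha (val (f i)) (x (j i))].
pose W := [pred f : {ffun I -> B} | [forall k, exists i, `[< eqv (tup f i) (x k) >]]].
have CW (f : {ffun I -> B}) : (forall i, C i (f i)) -> W f.
  move=> Cf; apply/forallP => k; apply/existsP; exists k.
  by rewrite /tup ffunE; exact: Cf.
have tup_inj : injective tup.
  move=> f g /ffunP fg; apply/ffunP => i; apply: val_inj.
  by have := fg i; rewrite !ffunE; exact: free_orbit_inj.
pose F := [fset y in [seq tup f | f in W]].
have FP y : reflect (exists2 f, W f & y = tup f) (y \in F).
  exact: fset_imageP.
have cF : #|` F| = #|W|.
  exact: card_fset_image.
have [f0 Wf0] : exists f, W f.
  have /choice[f fC] : forall k, exists b, C k b.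
    move=> k; have := jP k; rewrite cB => /(leq_trans V0).
    by rewrite muln_gt0 => /andP[_ /card_gt0P[b bC]]; exists b.
  by exists [ffun k => f k]; apply: CW => k; rewrite ffunE.
have cFV : (#|` F| <= Vol S r ^ #|I|)%N.
  by rewrite cF (leq_trans (max_card _)) // card_ffun cB.
apply: (@le_trans _ _ (#|` F|%:R)%:E); last by rewrite lee_fin ler_nat.
apply: (@folner_free_action R _ _ diag_act).
- by move=> y; apply/ffunP => i; rewrite ffunE.
- by move=> g h y; apply/ffunP => i; rewrite !ffunE.
- by apply/fset0Pn; exists (tup f0); apply/FP; exists f0.
- move=> y g /FP[f Wf ->]; apply: diag_act_free => [k|i].
    by have /existsP[i /asboolP] := forallP Wf k; exists i.
  by exists (val (f i)), (j i); rewrite ffunE.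
have bd_sub : (#|` act_boundary diag_act T F| <=
    #|[pred f | W f && [exists i, D (f i)]]|)%N.
  pose bad := [pred f | W f && [exists i, D (f i)]].
  rewrite -(size_image tup bad) cardfE cardE -(size_map val).
  apply: uniq_leq_size; first by rewrite map_inj_uniq ?enum_uniq //; exact: val_inj.
  move=> _ /mapP[y _ ->]; have := valP y.
  rewrite in_sep => /andP[/FP[f Wf yE] nsub].
  rewrite yE; apply/mapP; exists f => //.
  rewrite mem_enum inE [X in X && _]Wf /=.
  apply: contraNT nsub => /existsPn nD; apply/fsubsetP => _ /imfsetP[t /= tT ->].
  have /choice[s sP] : forall i, exists s, s \in S /\
      t (tup f i) = alpha s (tup f i).
    move=> i; have [k xk] := x_repr (tup f i).
    by have [s [sS _ st]] := eqv_local tT xk; exists s.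
  have sB i : (s i * val (f i))%g \in B.
    by apply: inner_boundaryPn (nD i) (sP i).1; exact: valP.
  (* The cocycle values of [t] keep all coordinates in [B], as none of the
     [b_i] is in its boundary, so only the meeting of all classes remains. *)
  have tupE : diag_act t (tup f) = tup [ffun i => [` sB i]%fset].
    by apply/ffunP => i; rewrite ffunE (sP i).2 !ffunE /= actM.
  apply/FP; exists [ffun i => [` sB i]%fset]; last by rewrite yE.
  apply/forallP => k; have tx : t ((t^-1)%g (x k)) = x k by exact: homeoVK.
  have [k' xk'] := x_repr ((t^-1)%g (x k)).
  have /existsP[i /asboolP yi] := forallP Wf k'.
  have yiz := eqv_trans yi xk'.
  apply/existsP; exists i; apply/asboolP; rewrite -tupE ffunE -tx.
  by have [u [uS -> ->]] := eqv_local tT yiz; exact: eqv_act.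
have cD : (#|D| <= #|` inner_boundary S B|)%N.
  rewrite cardE -(size_map val); apply: uniq_leq_size.
    by rewrite map_inj_uniq ?enum_uniq //; exact: val_inj.
  by move=> _ /mapP[b + ->]; rewrite mem_enum inE.
have := @card_bad_tuples _ _ D _ _ jP CW; rewrite cB => count.
apply: (@le_trans _ _ (#|[pred f | W f && [exists i, D (f i)]]|%:R)).
  by rewrite ler_nat.
rewrite cF -(@ler_pM2r _ (Vol S r)%:R) ?ltr0n // -natrM.
apply: le_trans (_ : (#|I| ^ #|I|.+1)%:R * d * (Vol S r)%:R * #|W|%:R <= _).
  rewrite -[_ * d * _]mulrA; apply: (@le_trans _ _
    ((#|I| ^ #|I|.+1)%:R * #|` inner_boundary S B|%:R * #|W|%:R)).
    rewrite -!natrM ler_nat; apply: leq_trans count _.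
    by rewrite leq_mul2r leq_mul2l cD !orbT.
  by rewrite ler_wpM2r // ler_wpM2l.
by rewrite mulrAC ler_wpM2r // ler_wpM2r.
Qed.

End FolnerBound.

(** * The Folner function of the generated subgroup *)

Theorem theoremA3 (R : realType) (X : metricType R) (G0 : groupType)
    (alpha : UMagmaMorphism.type G0 (homeo X)) (T : {fset homeo X})
    (X_cantor : homeomorphic cantor_space X)
    (G0_countable : countable [set: G0])
    (G0_growth : local_subexponential_growth R G0)
    (alpha_distal : distal alpha)
    (alpha_free : dense (free_points alpha))
    (T_full : [set` T] `<=` full_group alpha)
    (T_sym : symmetric_fset T) (T_id : 1%g \in T) :
  exists l : nat,
    forall (c : homeo X -> X -> discrete_topology G0) (S : {fset G0}),
      (forall phi, phi \in T -> orbit_cocycle alpha phi (c phi)) ->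
      [set` S] = \bigcup_(phi in [set` T]) range (c phi) ->
      symmetric_fset S -> 1%g \in S ->
      forall eps : R, 0 < eps -> delta_defined #|` T| #|` S| l eps ->
        let d := delta #|` T| #|` S| l eps in
        let m := `|Num.ceil (ln d / ln (1 - d))|%N in
        (folner T eps <= ((Psi S d m ^ l)%N%:R)%:E)%E.
Proof.
have X_compact : compact [set: X].
  have [f [g [_ gK fc _]]] := X_cantor.
  have -> : [set: X] = f @` [set: cantor_space].
    by apply/seteqP; split=> // x _; exists (g x).
  apply: continuous_compact cantor_space_compact.
  exact: continuous_subspaceT.
have [[c0 [S0 [c0P S0E S0_sym S0_one]]]|none] := pselect (exists
    (c : homeo X -> X -> discrete_topology G0) (S : {fset G0}),
    [/\ forall phi, phi \in T -> orbit_cocycle alpha phi (c phi),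
        [set` S] = \bigcup_(phi in [set` T]) range (c phi),
        symmetric_fset S & 1%g \in S]); last first.
  by exists 0%N => c S cP SE S_sym S_one; case: none; exists c, S.
pose E y z := forall phi, phi \in T -> c0 phi y = c0 phi z.
have E_clopen : clopen [set u : X * X | E u.1 u.2].
  apply: (clopen_forall_fset (P := fun phi => [set u : X * X |
    c0 phi u.1 = c0 phi u.2])) => phi phiT.
  by have [cc _] := c0P phi phiT; exact: (discrete_pair_clopen eq cc).
have [n stable] := agree_distal_stable X_compact alpha_distal S0_sym E_clopen.
pose eqv := agree alpha S0 E n.
have eqvxx y : eqv y y by move=> g _ phi _.
have eqv_sym y z : eqv y z -> eqv z y.
  by move=> yz g gB phi phiT; rewrite (yz g gB phi phiT).
have eqv_trans y z w : eqv y z -> eqv z w -> eqv y w.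
  by move=> yz zw g gB phi phiT; rewrite (yz g gB phi phiT); exact: zw.
have eqv_act s y z : s \in S0 -> eqv y z -> eqv (alpha s y) (alpha s z).
  by move=> sS /stable/(agree_step sS).
have eqv_local t y z : t \in T -> eqv y z ->
    exists s, [/\ s \in S0, t y = alpha s y & t z = alpha s z].
  move=> tT /(_ 1%g (ball_cayley1 _ _) t tT); rewrite !act1 => cyz.
  have [_ tE] := c0P t tT; exists (c0 t y); rewrite !tE -cyz; split=> //.
  have : (\bigcup_(phi in [set` T]) range (c0 phi)) (c0 t y).
    by exists t => //; exists y.
  by rewrite -S0E.
have [I [x [x_free x_repr]]] := free_representatives X_compact alpha_free
  (agree_clopen alpha S0 E_clopen n) eqvxx eqv_sym.
exists (#|I| ^ #|I|.+1 + #|I|)%N => c S cP SE S_sym S_one eps eps0.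
have {SE} -> : S = S0.
  suff /seteqP[SS0 S0S] : [set` S] = [set` S0].
    by apply/fsetP => s; apply/idP/idP; [exact: SS0|exact: S0S].
  rewrite SE S0E; apply: eq_bigcupr => phi phiT.
  by rewrite (cocycle_unique alpha_free (cP phi phiT) (c0P phi phiT)).
move=> dok /=; set d := delta _ _ _ _.
have T_gt0 : (0 < #|` T|)%N by rewrite cardfs_gt0; apply/fset0Pn; exists 1%g.
have S_gt0 : (0 < #|` S0|)%N by rewrite cardfs_gt0; apply/fset0Pn; exists 1%g.
have d0 : 0 < d by exact: delta_gt0.
have [d' /andP[d'0 d'd] ->] := Psi_succ S0 (delta_steps T_gt0 S_gt0 eps0 dok) d0.
have folner_ball := folner_radiusP G0_growth S0_sym d'0.
apply: le_trans (folner_tuples T_sym eqv_trans eqv_act eqv_local x_free x_repr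
  folner_ball _) _.
  apply: le_trans _ (delta_pow _ T_gt0 S_gt0 eps0).
  apply: ler_pM (ler0n _ _) (ltW d'0) _ d'd.
  rewrite -natrX ler_nat.
  by apply/ltnW/(leq_ltn_trans (leq_addr #|I| _))/ltn_expl.
by rewrite lee_fin ler_nat leq_pexp2l ?Vol_gt0 // leq_addl.
Qed.
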